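(* Let $q$ be a prime power and $m$ a positive integer with $\gcd(m,q)=1$. Then $C'(m,q)\cong\Sigma(m,q)$ and $C'(m,q)/\langle X\rangle\cong S(m,q)$.
   Context: $X$ is the $m\times m$ matrix over $\mathbb{F}_q$ of multiplication by $x$ on $\mathbb{F}_q[x]/(x^m-1)$ in the basis $1,x,\dots,x^{m-1}$ (an $m$-cycle permutation matrix); $C(m,q)$ is the group of units of the algebra $\mathbb{F}_q[X]$ of circulant matrices, and $C'(m,q)=\{C\in C(m,q): C\mathbf 1=\mathbf 1\}$ with $\mathbf 1$ the all-ones vector; equivalently $C'(m,q)$ is the group of residues $a(x)\in\mathbb{F}_q[x]/(x^m-1)$ with $\gcd(a,x^m-1)=1$ and $a(1)=1$, and $\langle X\rangle$ corresponds to $\langle x\rangle$. In $\mathbb{Q}[x]/(x^m-1)$ (exponents mod $m$) put $e_v=x^v-1$, $\epsilon_v=q\,e_v-e_{qv}$; $\mathcal Z_m$ = $\mathbb{Z}$-span of $e_1,\dots,e_{m-1}$, $\mathcal E_{m,q}$ = $\mathbb{Z}$-span of $\epsilon_1,\dots,\epsilon_{m-1}$, $\Sigma(m,q)=\mathcal Z_m/\mathcal E_{m,q}$; with $f_v=qx^v-\sum_{i=0}^{q-1}x^{qv+i}$, $S(m,q)=\mathcal Z_m/\langle f_1,\dots,f_{m-1}\rangle_{\mathbb{Z}}$ (the sandpile group of the generalized de Bruijn graph on $\mathbb{Z}_m$ with arcs $v\to qv+i$, $0\le i\le q-1$). *)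

(* Defs.v *)
From HB Require Import structures.
From mathcomp Require Import all_boot all_order all_fingroup all_algebra.

Set Implicit Arguments.
Unset Strict Implicit.
Unset Printing Implicit Defensive.

Import GRing.Theory.
Local Open Scope ring_scope.

(* x^m - 1 for m > 0. The exponent is spelled m.-1.+1 because {'GL_m[F]}
   consists of matrices of size m.-1.+1; {poly %/ cyc_poly R m} is then always
   the genuine quotient, as its modulus is monic of size at least 2. *)
Definition cyc_poly (R : nzRingType) (m : nat) : {poly R} := 'X^(m.-1.+1) - 1.

Lemma cyc_polyE (R : nzRingType) m : (0 < m)%N -> cyc_poly R m = 'X^m - 1.
Proof. by rewrite /cyc_poly => /prednK->. Qed.

Lemma cyc_poly_monic (R : nzRingType) m : cyc_poly R m \is monic.
Proof. exact: monicXnsubC. Qed.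

Lemma size_cyc_poly (R : nzRingType) m : size (cyc_poly R m) = m.-1.+2.
Proof. exact: size_XnsubC. Qed.

Lemma mk_monic_cyc_poly (R : nzRingType) m :
  mk_monic (cyc_poly R m) = cyc_poly R m.
Proof. by rewrite /mk_monic size_cyc_poly cyc_poly_monic. Qed.

Section CyclicAlgebra.

Variables (R : comNzRingType) (m : nat).

Local Notation x := ('qX : {poly %/ cyc_poly R m}).

Lemma cyc_qX_expm : x ^+ m.-1.+1 = 1.
Proof.
rewrite -rmorphXn -[RHS](rmorph1 (in_qpoly (cyc_poly R m))).
apply/eqP; rewrite -subr_eq0 -rmorphB; apply/eqP/val_inj.
by rewrite /= mk_monic_cyc_poly Pdiv.RingMonic.rmodpp ?cyc_poly_monic.
Qed.

Lemma cyc_qX_exp k : (x ^+ k : {poly R}) = 'X^(k %% m.-1.+1).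
Proof.
rewrite {1}(divn_eq k m.-1.+1) exprD mulnC exprM cyc_qX_expm expr1n mul1r.
rewrite -rmorphXn in_qpoly_small //.
by rewrite mk_monic_cyc_poly size_cyc_poly size_polyXn ltnS ltn_mod.
Qed.

End CyclicAlgebra.

Section Circulant.

Variables (F : finFieldType) (m : nat).

Local Notation A := {poly %/ cyc_poly F m}.
Local Notation x := ('qX : A).

(* Column j lists the coordinates of x * x^j in the basis 1, x, ... *)
Definition circ_X : 'M[F]_(m.-1.+1) :=
  \matrix_(i, j) (x * x ^+ j : {poly F})`_i.

Lemma circ_X_perm : circ_X = (perm_mx (perm (@ordS_inj m.-1.+1)))^T.
Proof.
apply/matrixP => i j; rewrite !mxE permE -exprS cyc_qX_exp coefXn.
by rewrite eq_sym.
Qed.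

Lemma circ_X_unit : circ_X \is a GRing.unit.
Proof. by rewrite circ_X_perm unitmx_tr unitmx_perm. Qed.

Definition circ_XGL : {'GL_m[F]} := FinRing.unit 'M[F]_m.-1.+1 circ_X_unit.

(* F[X], as the row space spanned by the powers of X below the degree of its
   minimal polynomial. *)
Definition circ_alg : 'A[F]_(degree_mxminpoly circ_X, m.-1.+1) :=
  powers_mx circ_X (degree_mxminpoly circ_X).

Lemma circ_algP (M : 'M[F]_(m.-1.+1)) :
  reflect (exists p, M = horner_mx circ_X p) (M \in circ_alg)%MS.
Proof.
apply: (iffP idP) => [/mx_inv_hornerK <-|[p ->]]; last exact: horner_mx_mem.
by eexists.
Qed.

Definition circ_units : {set {'GL_m[F]}} :=
  [set g | (GLval g \in circ_alg)%MS & (GLval g^-1 \in circ_alg)%MS].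

Lemma circ_units_group_set : group_set circ_units.
Proof.
have mem1 : (GLval (1 : {'GL_m[F]})%g \in circ_alg)%MS.
  by apply/circ_algP; exists 1; rewrite rmorph1.
apply/group_setP; split=> [|g h]; rewrite ?inE ?invg1 ?mem1 //.
move=> /andP[/circ_algP[a Ea] /circ_algP[b Eb]].
move=> /andP[/circ_algP[c Ec] /circ_algP[d Ed]].
rewrite invMg !GL_ME; apply/andP; split; apply/circ_algP.
  by exists (a * c); rewrite rmorphM Ea Ec.
by exists (d * b); rewrite rmorphM Eb Ed.
Qed.
Canonical circ_units_group := Group circ_units_group_set.

Definition circ_units1 : {set {'GL_m[F]}} :=
  [set g in circ_units | GLval g *m const_mx 1 == const_mx 1 :> 'cV_m.-1.+1].

Lemma circ_units1_group_set : group_set circ_units1.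
Proof.
apply/group_setP; split=> [|g h]; first by rewrite inE group1 mul1mx eqxx.
rewrite inE => /andP[Cg /eqP g1]; rewrite inE => /andP[Ch /eqP h1].
by rewrite inE groupM // GL_MxE -mulmxA h1 g1 eqxx.
Qed.
Canonical circ_units1_group := Group circ_units1_group_set.

Lemma circ_XGL_in : circ_XGL \in circ_units1.
Proof.
rewrite !inE; apply/andP; split; last first.
  apply/eqP/matrixP => i j.
  rewrite [GLval _]circ_X_perm tr_perm_mx -row_permE !mxE //.
apply/andP; split; first by apply/circ_algP; exists 'X; rewrite horner_mx_X.
suff -> : (circ_XGL^-1 = circ_XGL ^+ #[circ_XGL].-1)%g.
  apply/circ_algP; exists 'X^(#[circ_XGL]%g.-1).
  rewrite rmorphXn /= horner_mx_X; elim: (#[circ_XGL]%g.-1)%N => [|k IHk] //.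
  by rewrite expgS GL_ME IHk -exprS.
exact: invg_expg.
Qed.

End Circulant.

Section IntegralSpan.

Variables (V : vectType rat) (n : nat) (s : n.-tuple V).

Definition int_span : {pred V} := fun v => dec_Qint_span s v.

Lemma int_spanP v : reflect (inIntSpan s v) (v \in int_span).
Proof. exact: sumboolP. Qed.

Lemma int_span_zmod_closed : zmod_closed int_span.
Proof.
split=> [|u v /int_spanP[a ->] /int_spanP[b ->]]; apply/int_spanP.
  by exists 0; rewrite big1 // => i _; rewrite ffunE mulr0z.
exists (a - b); rewrite -sumrB; apply: eq_bigr => i _.
by rewrite !ffunE mulrzBr.
Qed.
HB.instance Definition _ :=
  GRing.isZmodClosed.Build V int_span int_span_zmod_closed.

Record lattice : predArgType :=
  Lattice { lattice_val :> V; _ : lattice_val \in int_span }.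
HB.instance Definition _ := [isSub for lattice_val].
HB.instance Definition _ := [Choice of lattice by <:].
HB.instance Definition _ := [SubChoice_isSubZmodule of lattice by <:].

End IntegralSpan.

Section LatticeQuotient.

Variables (V : vectType rat) (n k : nat) (s : n.-tuple V) (t : k.-tuple V).

(* The span of t inside the span of s; in both uses below the former is
   contained in the latter (cyc_eps_in, cyc_f_in). *)
Definition sublattice : {pred lattice s} := fun u => val u \in int_span t.

Lemma sublattice_zmod_closed : zmod_closed sublattice.
Proof.
split=> [|u v]; rewrite -!topredE /= /sublattice ?raddf0 ?rpred0 //.
by move=> tu tv; rewrite raddfB rpredB.
Qed.
HB.instance Definition _ :=
  GRing.isZmodClosed.Build (lattice s) sublattice sublattice_zmod_closed.

Definition lattice_quot : zmodType := Quotient.quot sublattice.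

End LatticeQuotient.

Section SigmaSandpile.

Variables (m q : nat).

Local Notation A := {poly %/ cyc_poly rat m}.
Local Notation x := ('qX : A).

Definition cyc_e (v : nat) : A := x ^+ v - 1.
Definition cyc_eps (v : nat) : A := cyc_e v *+ q - cyc_e (q * v).
Definition cyc_f (v : nat) : A :=
  x ^+ v *+ q - \sum_(i < q) x ^+ (q * v + i).

Definition Zgens : m.-1.-tuple A := [tuple cyc_e i.+1 | i < m.-1].
Definition Egens : m.-1.-tuple A := [tuple cyc_eps i.+1 | i < m.-1].
Definition Fgens : m.-1.-tuple A := [tuple cyc_f i.+1 | i < m.-1].

Lemma cyc_e_in v : cyc_e v \in int_span Zgens.
Proof.
have -> : cyc_e v = cyc_e (v %% m.-1.+1).
  congr (_ - _); apply/val_inj.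
  by rewrite [LHS]cyc_qX_exp [RHS]cyc_qX_exp modn_mod.
have: (v %% m.-1.+1 < m.-1.+1)%N by rewrite ltn_mod.
case: (v %% _)%N => [_|w lt_w]; first by rewrite /cyc_e expr0 subrr rpred0.
apply/int_spanP; exists [ffun i : 'I_m.-1 => (i == w :> nat)%:Z].
pose j := Ordinal (lt_w : (w < m.-1)%N).
rewrite (bigD1 j) // ffunE eqxx big1 => [|i neq_iw].
  by rewrite Monoid.mulm1 mulr1z -tnth_nth tnth_mktuple.
by rewrite ffunE (negPf (neq_iw : (i != w :> nat))) mulr0z.
Qed.

Lemma cyc_eps_in v : cyc_eps v \in int_span Zgens.
Proof. by rewrite rpredB ?rpredMn ?cyc_e_in. Qed.

Lemma cyc_f_in v : cyc_f v \in int_span Zgens.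
Proof.
have -> : cyc_f v = cyc_e v *+ q - \sum_(i < q) cyc_e (q * v + i).
  by rewrite sumrB mulrnBl sumr_const card_ord opprB addrA addrNK.
by rewrite rpredB ?rpredMn ?rpred_sum // => *; rewrite cyc_e_in.
Qed.

Definition Sigma_group : zmodType := lattice_quot Zgens Egens.
Definition sandpile_group : zmodType := lattice_quot Zgens Fgens.

End SigmaSandpile.

Definition isog_zmod (gT : finGroupType) (G : {set gT}) (V : zmodType) : Prop :=
  exists f : gT -> V,
    [/\ {in G &, {morph f : g h / (g * h)%g >-> g + h}},
        {in G &, injective f}
      & forall v, exists2 g, g \in G & f g = v].

(* Main.v *)
(* Write N = q^n - 1, where K is an extension of F of degree n containing the
   m-th roots of unity, gam a generator of K^* and zeta = gam^(N/m). Evaluation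
   at the powers of zeta identifies C'(m,q) with the functions d : Z/m -> K^*
   such that d(0) = 1 and d(qv) = d(v)^q. Taking logarithms in base gam, these
   are the columns h over Z/N, indexed by 1, ..., m-1, with M h = 0, where M is
   the matrix of the relations eps_v. If P is the permutation v |-> qv then
   M = q - P divides q^n - P^n = N, with cofactor M' = sum_i q^(n-1-i) P^i, so
   u |-> M' u induces an isomorphism from Z^(m-1)/M Z^(m-1) to C'(m,q). This is
   the column cokernel of M, while Sigma(m,q) is its row cokernel; the Smith
   normal form identifies them.

   In this description X is the class of M l / m with l = (1, ..., m-1). As
   (x - 1) f_v = eps_(v+1) - eps_v, the relation matrix B of S(m,q) satisfies
   B J = U M, where J is multiplication by x - 1, of determinant +-m, and U is
   unimodular. Since J^-1 Z^(m-1) = Z^(m-1) + Z l/m, the group C'(m,q)/<X> is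
   the column cokernel of U^-1 B, and again the Smith normal form concludes. *)

Require Import Defs.
From mathcomp Require Import all_boot all_order all_fingroup all_algebra.
From mathcomp Require Import all_solvable all_field.
From mathcomp Require Import zify ring.

Set Implicit Arguments.
Unset Strict Implicit.
Unset Printing Implicit Defensive.

Import GRing.Theory.
Local Open Scope ring_scope.

(** * Finite fields *)

(** The nonzero elements are #|K| - 1 distinct roots of unity of that order, so one of them is
    primitive. *)
Lemma finField_generator (K : finFieldType) :
  exists g : K, #|K|.-1.-primitive_root g.
Proof.
have K_gt1 := finNzRing_gt1 K.
have /hasP[g _ gP] : has #|K|.-1.-primitive_root (enum (predC1 (0 : K))).
  apply: has_prim_root; rewrite ?enum_uniq -?cardE ?cardC1 //.
    by rewrite -ltnS (ltn_predK K_gt1).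
  apply/allP => x; rewrite mem_enum => nz_x.
  rewrite unity_rootE; apply/eqP/(mulfI nz_x).
  by rewrite -exprS (ltn_predK K_gt1) expf_card mulr1.
by exists g.
Qed.

(** Take a splitting field of X^m - 1. This polynomial is separable because m is nonzero in F, so
    its m roots include a primitive one. *)
Lemma finField_ext_unity_roots (F : finFieldType) (m : nat) :
    coprime m #|F| ->
  exists (K : finFieldType) (iota : {rmorphism F -> K}) (n : nat),
    #|K| = (#|F| ^ n)%N /\ (m %| #|K|.-1)%N.
Proof.
move=> co_mF.
have m_gt0 : (0 < m)%N.
  case: m co_mF => //; rewrite /coprime gcd0n => /eqP F1.
  by have := finNzRing_gt1 F; rewrite F1.
have nz_p : 'X^m - 1 != 0 :> {poly F} by rewrite monic_neq0 ?monicXnsubC.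
have [L /= [rs Drs _]] := FinSplittingFieldFor nz_p.
pose K := FinFieldExtType L.
have oK : #|K| = (#|F| ^ \dim {:L})%N.
  have := card_vspace (fullv : {vspace finvect_type L}).
  by rewrite card_vspacef.
have nz_m : m%:R != 0 :> L.
  have [p p_pr pF] := finPcharP F.
  rewrite -(rmorph_nat (in_alg L)) fmorph_eq0 -(dvdn_pcharf pF).
  have pdF : (p %| #|F|)%N.
    rewrite (card_pprimeChar pF) dvdn_exp // lt0n.
    apply: contraTneq (finNzRing_gt1 F) => lg0.
    by rewrite -leqNgt (card_pprimeChar pF) lg0.
  apply/negP => pdm; have := coprime_dvdl pdm co_mF.
  by rewrite prime_coprime // pdF.
have {}Drs : 'X^m - 1 %= \prod_(z <- rs) ('X - z%:P).
  by move: Drs; rewrite rmorphB rmorph1 rmorphXn /= map_polyX.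
have Urs : uniq rs.
  rewrite -separable_prod_XsubC -(eqp_separable Drs).
  by rewrite separable_Xn_sub_1.
have szrs : size rs = m.
  by have := eqp_size Drs; rewrite size_prod_XsubC size_XnsubC // => -[].
have rs1 : all m.-unity_root rs.
  apply/allP => z rsz; rewrite /root_of_unity (eqp_root Drs).
  by rewrite root_prod_XsubC.
have /hasP[z _ z_prim] : has m.-primitive_root rs.
  by apply: has_prim_root; rewrite ?szrs.
exists K, (in_alg L), (\dim {:L}); split=> //.
rewrite (prim_order_dvd (z_prim : m.-primitive_root (z : K))).
have nz_z : (z : K) != 0.
  apply/negP => /eqP z0; have /eqP := prim_expr_order z_prim.
  by rewrite (z0 : z = 0) expr0n gtn_eqF // eq_sym oner_eq0.
apply/eqP/(mulfI nz_z).
rewrite -exprS (ltn_predK (finNzRing_gt1 K)) mulr1.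
exact: (expf_card (F := K)).
Qed.

(** Over F, X^q - X is the product of all X - y, so it has no roots in K outside the image of F. *)
Lemma finField_fixed (F K : finFieldType) (iota : {rmorphism F -> K}) x :
  x ^+ #|F| = x -> exists y, x = iota y.
Proof.
move=> xF; have: root (map_poly iota ('X^#|F| - 'X)) x.
  by rewrite rmorphB rmorphXn /= map_polyX rootE !hornerE xF subrr.
rewrite finField_genPoly rmorph_prod /=.
under eq_bigr do rewrite rmorphB /= map_polyX map_polyC /=.
rewrite rootE horner_prod prodf_seq_eq0 => /hasP[y _].
by rewrite !hornerE subr_eq0 => /eqP ->; exists y.
Qed.

Lemma exprD_card_finField (F : finFieldType) (K : fieldType)
    (iota : {rmorphism F -> K}) :
  {morph (fun x : K => x ^+ #|F|) : x y / x + y}.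
Proof.
move=> x y; apply: exprDn_pchar.
have [p p_pr pF] := finPcharP F.
have pK : p \in [pchar K] by rewrite (fmorph_pchar iota).
rewrite (card_pprimeChar pF) pnatX; apply/orP; left.
by rewrite pnatE.
Qed.

Lemma exprz_prim_eq1 (K : fieldType) (g : K) N (z : int) :
  N.-primitive_root g -> (g ^ z == 1) = (N %| z)%Z.
Proof.
move=> gN; case: z => k; rewrite dvdzE /= (prim_order_dvd gN) //.
by rewrite NegzE -[g ^ _]/(g ^- k.+1) invr_eq1.
Qed.

(** * Row and column cokernels *)

Section IntComb.

Variables (V : vectType rat) (r : nat).
Implicit Types (s t : r.-tuple V) (a b : 'rV[int]_r).

Definition int_comb s a : V := \sum_i tnth s i *~ a 0 i.

Lemma int_combB s a b : int_comb s (a - b) = int_comb s a - int_comb s b.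
Proof. by rewrite -sumrB; apply: eq_bigr => i _; rewrite !mxE mulrzBr. Qed.

Lemma int_combD s a b : int_comb s (a + b) = int_comb s a + int_comb s b.
Proof. by rewrite -big_split; apply: eq_bigr => i _; rewrite !mxE mulrzDr. Qed.

Lemma int_comb_delta s i :
  int_comb s (delta_mx 0 i) = tnth s i.
Proof.
rewrite /int_comb (bigD1 i) //= mxE !eqxx mulr1z big1 ?addr0 // => j neq_ji.
by rewrite mxE (negPf neq_ji) andbF mulr0z.
Qed.

Lemma int_comb0 s : int_comb s 0 = 0.
Proof. by rewrite /int_comb big1 // => i _; rewrite mxE mulr0z. Qed.

Lemma int_combMn s a k :
  int_comb s (a *+ k) = int_comb s a *+ k.
Proof.
by elim: k => [|k IHk]; rewrite ?mulr0n ?int_comb0 // !mulrS int_combD IHk.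
Qed.

Lemma int_comb_sum s k (c : 'I_k -> 'rV_r) :
  int_comb s (\sum_i c i) = \sum_i int_comb s (c i).
Proof. exact: (big_morph _ (int_combD s) (int_comb0 s)). Qed.

Lemma int_span_combP s v :
  reflect (exists a, v = int_comb s a) (v \in int_span s).
Proof.
apply: (iffP (int_spanP s v)) => [[a ->]|[a ->]].
  exists (\row_i a i); apply: eq_bigr => i _; rewrite mxE.
  by rewrite (tnth_nth 0).
by exists [ffun i => a 0 i]; apply: eq_bigr => i _; rewrite ffunE (tnth_nth 0).
Qed.

Lemma int_comb_mulmx s t (B : 'M[int]_r) :
    (forall i, tnth t i = int_comb s (row i B)) ->
  forall a, int_comb t a = int_comb s (a *m B).
Proof.
move=> tE a; rewrite /int_comb.
under eq_bigr do rewrite tE /int_comb mulrz_suml.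
rewrite exchange_big /=; apply: eq_bigr => j _; rewrite mxE mulrz_sumr.
by apply: eq_bigr => i _; rewrite mxE -mulrzA mulrC.
Qed.

End IntComb.

(* The Smith normal form identifies the cokernel of B acting on columns, which
   is G, with the cokernel of B acting on rows, which is the lattice quotient. *)
Lemma isog_lattice_quot (gT : finGroupType) (G : {set gT}) (V : vectType rat)
    (r : nat) (s t : r.-tuple V) (B U : 'M[int]_r) (Psi : 'cV[int]_r -> gT) :
    (forall a, int_comb s a = 0 -> a = 0) ->
    (forall i, tnth t i = int_comb s (row i B)) ->
    U \in unitmx ->
    {morph Psi : u v / u + v >-> (u * v)%g} ->
    (forall g, g \in G <-> exists u, Psi u = g) ->
    (forall u, Psi u = 1%g <-> exists z, U *m u = B *m z) ->
  isog_zmod G (lattice_quot s t).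
Proof.
move=> s_free tE Uunit PsiD PsiG Psi1.
have [L uL [R uR [d _ BE]]] := int_Smith_normal_form B.
set D := \matrix_(i, j) _ in BE.
have DT : D^T = D.
  by apply/matrixP => i j; rewrite !mxE eq_sym; case: eqP => // ->.
(* Since B = L D R with D symmetric, U u lies in B Z^r iff L^-1 U u lies in D Z^r, iff [x u] lies in
   the row space Z^r D R = Z^r B. *)
pose x (u : 'cV[int]_r) := (invmx L *m (U *m u))^T *m R.
have xD u v : x (u + v) = x u + x v.
  by rewrite /x !mulmxDr linearD mulmxDl.
have xP u : int_comb s (x u) \in int_span s by apply/int_span_combP; eexists.
pose th u : lattice_quot s t :=
  \pi_(Quotient.quot (@sublattice _ _ _ s t))%qT (Lattice (xP u)).
have thD u v : th (u + v) = th u + th v.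
  rewrite /th -[RHS]raddfD; congr (\pi%qT _); apply: val_inj => /=.
  by rewrite xD int_combD.
have Psi0 : Psi 0 = 1%g by apply: (mulgI (Psi 0)); rewrite -PsiD addr0 mulg1.
have th0 : th 0 = 0 by apply: (addrI (th 0)); rewrite -thD !addr0.
have thN u : th (- u) = - th u.
  by apply: (addrI (th u)); rewrite -thD !subrr.
have PsiN u : Psi (- u) = (Psi u)^-1%g.
  by apply: (mulgI (Psi u)); rewrite -PsiD subrr mulgV.
have th_eq0 u : th u = 0 <-> Psi u = 1%g.
  apply: iff_trans (iff_sym (Psi1 u)).
  apply: (@iff_trans _ (int_comb s (x u) \in int_span t)).
    rewrite -th0; split=> [/eqP|ut]; last apply/eqP.
      rewrite -Quotient.idealrBE -topredE /= /sublattice /= -int_combB.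
      by rewrite {2}/x !mulmx0 trmx0 mul0mx subr0.
    rewrite -Quotient.idealrBE -topredE /= /sublattice /= -int_combB.
    by rewrite {2}/x !mulmx0 trmx0 mul0mx subr0.
  split=> [/int_span_combP[y]|[z uE]]; last first.
    apply/int_span_combP; exists ((R *m z)^T *m invmx L).
    rewrite (int_comb_mulmx tE) /x uE {1}BE -!mulmxA mulKmx // trmx_mul DT BE.
    by rewrite -!mulmxA mulKmx.
  rewrite (int_comb_mulmx tE) => /eqP; rewrite -subr_eq0 -int_combB => /eqP.
  move=> /s_free /eqP; rewrite subr_eq0 => /eqP.
  rewrite BE /x mulmxA => /(can_inj (mulmxK uR)) /(congr1 trmx).
  rewrite trmxK mulmxA trmx_mul DT => /(congr1 (mulmx L)).
  rewrite mulKVmx // => ->.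
  by exists (invmx R *m (y *m L)^T); rewrite -!mulmxA mulKVmx.
have th_onto v : exists u, th u = v.
  elim/quotW: v => -[v sv]; have /int_span_combP[a va] := sv.
  exists (invmx U *m (L *m (a *m invmx R)^T)).
  congr (\pi%qT _); apply: val_inj => /=.
  by rewrite va /x mulKVmx // mulKmx // trmxK mulmxKV.
(* The isomorphism is [th] after a section of [Psi]; equal kernels make the choice of section
   irrelevant. Outside [G] any value will do. *)
have choiceG g : exists u, (g \in G) ==> (Psi u == g).
  have [/PsiG[u <-]|] := boolP (g \in G); last by exists 0.
  by exists u; rewrite eqxx implybT.
pose h g := xchoose (choiceG g).
have hK g : g \in G -> Psi (h g) = g.
  by move=> Gg; apply/eqP/(implyP (xchooseP (choiceG g))).
have thE u v : Psi u = Psi v -> th u = th v.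
  move=> uv; apply/eqP; rewrite -subr_eq0 -thN -thD; apply/eqP/th_eq0.
  by rewrite PsiD PsiN uv mulgV.
exists (th \o h); split=> [g k Gg Gk|g k Gg Gk|v] /=.
- rewrite -thD; apply: thE; rewrite PsiD !hK //.
  by apply/PsiG; exists (h g + h k); rewrite PsiD !hK.
- move=> hgk; rewrite -(hK g) // -(hK k) //; apply/eqP.
  rewrite eq_mulgV1 -PsiN -PsiD; apply/eqP/th_eq0.
  by rewrite thD thN hgk subrr.
- have [u <-] := th_onto v; have Gu : Psi u \in G by apply/PsiG; exists u.
  by exists (Psi u) => //; apply: thE; rewrite hK.
Qed.

(** * Integer functions on Z/m *)

Section CyclicFunctions.

Variable r : nat.
Local Notation m := r.+1.
Implicit Types (u w y z : 'cV[int]_r) (g h : nat -> int) (v : nat).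

(* Columns in Z^r stand for the functions on Z/m vanishing at 0: [ext u] is the
   function with values u, [vec g] the column of values of g at 1, ..., m - 1,
   and [idx v] the coordinate vector of e_v. *)
Definition idx v : 'rV[int]_r := \row_j (j.+1 == v %% m)%N%:Z.
Definition ext u v : int := (idx v *m u) 0 0.
Definition vec g : 'cV[int]_r := \col_i g i.+1.

Definition cyclic_fun g := (forall v, g (v %% m)%N = g v) /\ g 0 = 0.

Lemma idx_mod v : idx (v %% m) = idx v.
Proof. by apply/rowP => j; rewrite !mxE modn_mod. Qed.

Lemma idx0 : idx 0 = 0.
Proof. by apply/rowP => j; rewrite !mxE mod0n. Qed.

Lemma idx_ord (i : 'I_r) : idx i.+1 = delta_mx 0 i.
Proof.
apply/rowP => j; rewrite !mxE modn_small ?ltnS // eqSS eqxx -val_eqE.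
by case: eqP.
Qed.

Lemma ext_ord u (i : 'I_r) : ext u i.+1 = u i 0.
Proof. by rewrite /ext idx_ord -rowE mxE. Qed.

Lemma ext_cyclic u : cyclic_fun (ext u).
Proof.
by split=> [v|]; rewrite /ext ?idx_mod // idx0 mul0mx mxE.
Qed.

Lemma ext_mod u v : ext u (v %% m)%N = ext u v.
Proof. by case: (ext_cyclic u). Qed.

Lemma ext0 u : ext u 0 = 0.
Proof. by case: (ext_cyclic u). Qed.

Lemma ext_eq_mod u v k : v = k %[mod m] -> ext u v = ext u k.
Proof. by move=> vw; rewrite -ext_mod vw ext_mod. Qed.

Lemma cyclic_fun_ext g h : cyclic_fun g -> cyclic_fun h ->
  (forall i : 'I_r, g i.+1 = h i.+1) -> g =1 h.
Proof.
move=> [gm g0] [hm h0] gh v; rewrite -gm -hm.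
have: (v %% m < m)%N by rewrite ltn_mod.
case: (v %% m)%N => [_|i lt_i]; first by rewrite g0.
by rewrite (gh (Ordinal (lt_i : (i < r)%N))).
Qed.

Lemma ext_vec g : cyclic_fun g -> ext (vec g) =1 g.
Proof.
move=> gP; apply: cyclic_fun_ext (ext_cyclic _) gP _ => i.
by rewrite ext_ord mxE.
Qed.

Lemma vec_ext u : vec (ext u) = u.
Proof. by apply/colP => i; rewrite mxE ext_ord. Qed.

Lemma eq_vec g h : g =1 h -> vec g = vec h.
Proof. by move=> gh; apply/colP => i; rewrite !mxE gh. Qed.

Lemma extD u w v : ext (u + w) v = ext u v + ext w v.
Proof. by rewrite /ext mulmxDr mxE. Qed.

Lemma extB u w v : ext (u - w) v = ext u v - ext w v.
Proof. by rewrite /ext mulmxBr mxE [X in _ + X]mxE. Qed.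

Lemma extMn u k v : ext (u *+ k) v = ext u v *+ k.
Proof. by rewrite /ext -scaler_nat -scalemxAr mxE mulr_natl. Qed.

(** Used to cancel m or N from identities that are proved only after multiplication by it. *)
Lemma mulcn_inj k : (0 < k)%N -> injective (fun u : 'cV[int]_r => u *+ k).
Proof.
move=> k_gt0 u w /colP uw; apply/colP => i; have := uw i.
by rewrite !mulmxnE => /Num.Theory.pmulrnI ->.
Qed.

(** * The relation matrices and the maps J and M' *)

Section Matrices.

Variable q : nat.

(** [eps_mx], [f_mx] and [diff_mx] are the matrices M, B and U of the overview; row i belongs to v =
    i + 1. *)
Definition eps_mx : 'M[int]_r :=
  \matrix_(i < r) (idx i.+1 *+ q - idx (q * i.+1)).
Definition f_mx : 'M[int]_r :=
  \matrix_(i < r) (idx i.+1 *+ q - \sum_(k < q) idx (q * i.+1 + k)).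
Definition diff_mx : 'M[int]_r := \matrix_(i < r) (idx i.+2 - idx i.+1).

Lemma mul_rows_col (f : nat -> 'rV[int]_r) u :
  (\matrix_(i < r) f i.+1) *m u = vec (fun v => (f v *m u) 0 0).
Proof.
apply/colP => i; rewrite !mxE.
by apply: eq_bigr => j _; rewrite !mxE.
Qed.

Lemma mul_eps_mx u :
  eps_mx *m u = vec (fun v => ext u v *+ q - ext u (q * v)).
Proof.
rewrite (mul_rows_col (fun v => idx v *+ q - idx (q * v))); apply: eq_vec => v.
rewrite mulmxBl -scaler_nat -scalemxAl [LHS]mxE [X in X + _]mxE mulr_natl.
by rewrite [X in _ + X]mxE.
Qed.

Lemma mul_f_mx u :
  f_mx *m u = vec (fun v => ext u v *+ q - \sum_(k < q) ext u (q * v + k)).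
Proof.
rewrite (mul_rows_col (fun v => idx v *+ q - \sum_(k < q) idx (q * v + k))).
apply: eq_vec => v; rewrite mulmxBl -scaler_nat -scalemxAl mulmx_suml.
by rewrite [LHS]mxE [X in X + _]mxE mulr_natl [X in _ + X]mxE summxE.
Qed.

Lemma mul_diff_mx u : diff_mx *m u = vec (fun v => ext u v.+1 - ext u v).
Proof.
rewrite (mul_rows_col (fun v => idx v.+1 - idx v)); apply: eq_vec => v.
by rewrite mulmxBl [LHS]mxE [X in _ + X]mxE.
Qed.

(** The matrix is upper bidiagonal with -1 on the diagonal; in the last row [idx m] is 0. *)
Lemma diff_mx_unit : diff_mx \in unitmx.
Proof.
have trigT : is_trig_mx diff_mx^T.
  apply/is_trig_mxP => i j lt_ij; rewrite !mxE.
  rewrite (@modn_small j.+1) ?ltnS // eqSS (ltn_eqF lt_ij) subr0.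
  case: (leqP j.+2 r) => [lt_j|le_j].
    by rewrite modn_small // ltn_eqF // ltnS ltnW.
  have -> : j.+2 = m by have := ltn_ord j; lia.
  by rewrite modnn.
rewrite -unitmx_tr unitmxE det_trig //.
apply: (big_ind (fun x : int => x \is a GRing.unit)) => [|x y ux uy|i _].
- exact: unitr1.
- by rewrite unitrM ux.
rewrite !mxE (@modn_small i.+1) ?ltnS // eqxx.
case: (leqP i.+2 r) => [lt_i|le_i]; first by rewrite modn_small // ltn_eqF.
have -> : i.+2 = m by have := ltn_ord i; lia.
by rewrite modnn.
Qed.

Lemma eps_cyclic u : cyclic_fun (fun v => ext u v *+ q - ext u (q * v)).
Proof.
split=> [v|]; last by rewrite muln0 ext0 mul0rn subr0.
by rewrite ext_mod; congr (_ - _); apply: ext_eq_mod; rewrite modnMmr.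
Qed.

Lemma ext_eps_mx u v : ext (eps_mx *m u) v = ext u v *+ q - ext u (q * v).
Proof. by rewrite mul_eps_mx ext_vec //; apply: eps_cyclic. Qed.

(* The product M' u, where M' = sum_i q^(n-1-i) P^i. *)
Definition trace_vec n u : 'cV[int]_r :=
  vec (fun v => \sum_(i < n) ext u (q ^ i * v) *+ (q ^ (n - i.+1))).

Lemma trace_cyclic n u :
  cyclic_fun (fun v => \sum_(i < n) ext u (q ^ i * v) *+ (q ^ (n - i.+1))).
Proof.
split=> [v|]; last by rewrite big1 // => i _; rewrite muln0 ext0 mul0rn.
apply: eq_bigr => i _; congr (_ *+ _).
by apply: ext_eq_mod; rewrite modnMmr.
Qed.

Lemma ext_trace_vec n u v :
  ext (trace_vec n u) v = \sum_(i < n) ext u (q ^ i * v) *+ (q ^ (n - i.+1)).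
Proof. by rewrite ext_vec //; apply: trace_cyclic. Qed.

Lemma trace_vecD n u w : trace_vec n (u + w) = trace_vec n u + trace_vec n w.
Proof.
apply/colP => i; rewrite !mxE -big_split; apply: eq_bigr => j _.
by rewrite extD mulrnDl.
Qed.

Lemma trace_vecMn n u k : trace_vec n (u *+ k) = trace_vec n u *+ k.
Proof.
apply/colP => i; rewrite mulmxnE !mxE -sumrMnl; apply: eq_bigr => j _.
by rewrite extMn mulrnAC.
Qed.

(** This is (q - P) M' = q^n - P^n at v, where P^n = 1 because q^n = 1 mod m. *)
Lemma trace_telescope n u v : q ^ n = 1 %[mod m] ->
  \sum_(i < n)
      (ext u (q ^ i * v) *+ q - ext u (q ^ i.+1 * v)) *+ (q ^ (n - i.+1))
    = ext u v *+ (q ^ n) - ext u v.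
Proof.
move=> qn1.
have -> : ext u v *+ (q ^ n) - ext u v
  = - (ext u (q ^ n * v) *+ (q ^ (n - n)) - ext u (q ^ 0 * v) *+ (q ^ (n - 0))).
  rewrite subnn subn0 expn0 mul1n opprB; congr (_ - _).
  by apply: ext_eq_mod; rewrite -modnMml qn1 modnMml mul1n.
rewrite -(telescope_sumr (fun i => ext u (q ^ i * v) *+ (q ^ (n - i)))) //.
rewrite big_mkord -sumrN; apply: eq_bigr => i _.
by rewrite opprB mulrnBl -mulrnA -expnS subnSK.
Qed.

Lemma trace_vec_eps n u : q ^ n = 1 %[mod m] ->
  trace_vec n (eps_mx *m u) = u *+ (q ^ n) - u.
Proof.
move=> qn1; rewrite -[RHS]vec_ext; apply: eq_vec => v.
rewrite extB extMn.
rewrite -(trace_telescope u v qn1); apply: eq_bigr => i _.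
by rewrite ext_eps_mx mulnA -expnS.
Qed.

Lemma eps_trace_vec n u : q ^ n = 1 %[mod m] ->
  eps_mx *m trace_vec n u = u *+ (q ^ n) - u.
Proof.
move=> qn1; rewrite mul_eps_mx -[RHS]vec_ext; apply: eq_vec => v.
rewrite extB extMn.
rewrite -(trace_telescope u v qn1) !ext_trace_vec -sumrMnl -sumrB.
apply: eq_bigr => i _; rewrite mulrnBl mulrnAC; congr (_ - _ *+ _).
by rewrite mulnA -expnSr.
Qed.

(* [x_vec] is M l / m for l = [lin_vec]: the class of X. *)
Definition lin_vec : 'cV[int]_r := vec (fun v => (v %% m)%N%:Z).
Definition x_vec : 'cV[int]_r := vec (fun v => (q * (v %% m) %/ m)%N%:Z).

Lemma ext_lin_vec v : ext lin_vec v = (v %% m)%N%:Z.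
Proof. by rewrite ext_vec //; split=> [w|]; rewrite ?modn_mod ?mod0n. Qed.

(** Division with remainder: q a - (q a mod m) is m times the quotient of q a by m. *)
Lemma x_vecMm : x_vec *+ m = eps_mx *m lin_vec.
Proof.
rewrite mul_eps_mx; apply/colP => i.
rewrite [LHS]mulmxnE mxE [RHS]mxE !ext_lin_vec -modnMmr.
set a := (i.+1 %% m)%N; have := divn_eq (q * a) m; lia.
Qed.

(** The map J: (x - 1) e_v = e_(v+1) - e_v - e_1. *)
Definition shift_vec y : 'cV[int]_r :=
  vec (fun v => ext y v.+1 - ext y v - ext y 1).

Lemma ext_shift_vec y v : ext (shift_vec y) v = ext y v.+1 - ext y v - ext y 1.
Proof.
rewrite ext_vec //; split=> [w|]; last by rewrite ext0 subr0 subrr.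
rewrite ext_mod; congr (_ - _ - _); apply: ext_eq_mod.
by rewrite -addn1 modnDml addn1.
Qed.

(* (x - 1) f_v = eps_(v+1) - eps_v, transposed. *)
Lemma f_mx_shift y : f_mx *m shift_vec y = diff_mx *m (eps_mx *m y).
Proof.
rewrite mul_f_mx mul_diff_mx; apply: eq_vec => v.
rewrite !ext_eps_mx ext_shift_vec.
under eq_bigr do rewrite ext_shift_vec -addnS.
rewrite sumrB sumr_const card_ord.
(* The sum telescopes to the difference of the values at q (v + 1) and q v; the q copies of
   [ext y 1] cancel. *)
rewrite -(big_mkord xpredT (fun k => ext y (q * v + k.+1) - ext y (q * v + k))).
rewrite (telescope_sumr (fun k => ext y (q * v + k))) // addn0 -mulnSr.
by rewrite !mulrnBl; ring.
Qed.

Definition last_vec : 'cV[int]_r := vec (fun v => (v == r)%N%:Z).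

(** The function l grows by l(1) at each step, except from m - 1 to m, where it falls back to 0. *)
Lemma shift_lin_vec : shift_vec lin_vec = - (last_vec *+ m).
Proof.
apply/colP => i; rewrite [RHS]mxE mulmxnE !mxE !ext_lin_vec.
have lt_i := ltn_ord i.
rewrite (@modn_small i.+1) // (@modn_small 1) ?ltnS; last by lia.
have [Ei|neq_i] := eqVneq i.+1 r; last by rewrite modn_small; lia.
by rewrite Ei modnn; lia.
Qed.

(** After multiplication by m this is B J l = U M l. *)
Lemma f_mx_last : f_mx *m last_vec = - (diff_mx *m x_vec).
Proof.
apply: (mulcn_inj (ltn0Sn r)) => /=.
rewrite mulNrn -!raddfMn /= x_vecMm -f_mx_shift shift_lin_vec.
by rewrite mulmxN opprK.
Qed.

(** The partial sums w of z satisfy J w = z except at m - 1, where wrapping around loses the total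
    sum s. *)
Lemma shift_vec_decomp z :
  exists w s, z = shift_vec w + last_vec *~ s.
Proof.
exists (vec (fun v => \sum_(k < v %% m) ext z k)), (\sum_(k < m) ext z k).
apply/colP => i.
rewrite mxE -scaler_int [X in _ + X]mxE intz !(mxE _ (fun _ _ => _)).
rewrite !ext_vec; do ?by split=> [w|]; rewrite ?modn_mod // mod0n big_ord0.
have lt_i := ltn_ord i.
rewrite (@modn_small i.+1) // (@modn_small 1) ?ltnS; last by lia.
rewrite big_ord1 ext0 subr0.
have [Ei|neq_i] := eqVneq i.+1 r; last first.
  rewrite modn_small; last by lia.
  by rewrite big_ord_recr /= ext_ord mulr0 addr0; ring.
rewrite Ei modnn big_ord0 [\sum_(k < m) _]big_ord_recr /= sub0r mulr1 addKr.
by rewrite -(ext_ord z i) Ei.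
Qed.

(** U carries M Z^r + Z [x_vec] onto B Z^r, because Z^r is spanned by the image of J and [last_vec].
    This computes the kernel modulo <X>. *)
Lemma diff_in_f_mxP u :
  (exists w c, u = eps_mx *m w + x_vec *~ c) <->
  (exists z, diff_mx *m u = f_mx *m z).
Proof.
have mulmxMz (A : 'M[int]_r) (y : 'cV_r) c : A *m (y *~ c) = (A *m y) *~ c.
  exact: (raddfMz (mulmx A)).
split=> [[w [c ->]]|[z uz]].
  exists (shift_vec w - last_vec *~ c).
  by rewrite mulmxDr mulmxBr f_mx_shift !mulmxMz f_mx_last mulNrz opprK.
have [w [s zE]] := shift_vec_decomp z; exists w, (- s).
apply: (can_inj (mulKmx diff_mx_unit)).
by rewrite uz zE !mulmxDr f_mx_shift !mulmxMz f_mx_last mulrNz mulNrz.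
Qed.

End Matrices.

End CyclicFunctions.

(** * Coordinates with respect to the e_v *)

Section Generators.

Variable r : nat.
Local Notation m := r.+1.

Lemma int_comb_Zgens v : int_comb (Zgens m) (idx r v) = cyc_e m v.
Proof.
have -> : cyc_e m v = cyc_e m (v %% m).
  congr (_ - _); apply/val_inj.
  by rewrite [LHS]cyc_qX_exp [RHS]cyc_qX_exp modn_mod.
rewrite -idx_mod; have: (v %% m < m)%N by rewrite ltn_mod.
case: (v %% m)%N => [_|w lt_w].
  by rewrite idx0 int_comb0 /cyc_e expr0 subrr.
rewrite (idx_ord (Ordinal (lt_w : (w < r)%N))) int_comb_delta.
exact: tnth_mktuple.
Qed.

(** The constants -1 affect only degree 0, so the coefficient in degree j + 1 is a_j. *)
Lemma Zgens_free a : int_comb (Zgens m) a = 0 -> a = 0.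
Proof.
move=> a0; apply/rowP => j; rewrite mxE.
have := congr1 (fun p : {poly %/ cyc_poly rat m} => (p : {poly rat})`_j.+1) a0.
rewrite /int_comb /= raddf_sum /= coef_sum coef0.
have coef_e (i : 'I_r) :
    (tnth (Zgens m) i *~ a 0 i : {poly rat})`_j.+1 = (j == i)%:R *~ a 0 i.
  rewrite raddfMz /= -scaler_int coefZ mulrzl tnth_mktuple raddfB /=.
  rewrite [X in X - _](@cyc_qX_exp rat m).
  by rewrite modn_small ?ltnS // coefB coefXn eqSS coefC subr0.
under eq_bigr do rewrite coef_e.
rewrite (bigD1 j) //= eqxx big1 => [|i neq_ij]; last first.
  by rewrite eq_sym (negPf neq_ij) mul0rz.
by rewrite addr0 => /eqP; rewrite intr_eq0 => /eqP.
Qed.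

Variable q : nat.

Lemma Egens_comb i :
  tnth (Egens m q) i = int_comb (Zgens m) (row i (eps_mx r q)).
Proof.
by rewrite tnth_mktuple rowK int_combB int_combMn !int_comb_Zgens.
Qed.

Lemma Fgens_comb i :
  tnth (Fgens m q) i = int_comb (Zgens m) (row i (f_mx r q)).
Proof.
rewrite tnth_mktuple rowK int_combB int_combMn int_comb_sum int_comb_Zgens.
under [X in _ - X]eq_bigr do rewrite int_comb_Zgens.
by rewrite sumrB mulrnBl sumr_const card_ord opprB addrA addrNK.
Qed.

End Generators.

(** * Circulant matrices *)

Section Circulant.

Variables (F K : finFieldType) (iota : {rmorphism F -> K}) (r n : nat).
Local Notation m := r.+1.
Local Notation q := #|F|.
Local Notation N := #|K|.-1.
Hypotheses (oK : #|K| = (q ^ n)%N) (mN : (m %| N)%N).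
Variables (gam zeta : K).
Hypotheses (gamP : N.-primitive_root gam) (zetaE : zeta = gam ^+ (N %/ m)).
Local Notation X := (circ_X F m).

Let zetaP : m.-primitive_root zeta.
Proof. by rewrite zetaE; apply: dvdn_prim_root. Qed.

Let qn : (q ^ n = N.+1)%N.
Proof. by rewrite -oK (ltn_predK (finNzRing_gt1 K)). Qed.

Let N_gt0 : (0 < N)%N.
Proof. exact: prim_order_gt0 gamP. Qed.

Let qn1 : q ^ n = 1 %[mod m].
Proof. by rewrite qn -addn1 -modnDml (eqP mN) add0n. Qed.

Let n_gt0 : (0 < n)%N.
Proof. by case: n qn N_gt0 => // [[<-]]. Qed.

Let gam_neq0 : gam != 0.
Proof.
apply/negP => /eqP g0; have /eqP := prim_expr_order gamP.
by rewrite g0 expr0n gtn_eqF // eq_sym oner_eq0.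
Qed.

Let zeta_mod k : zeta ^+ (k %% m) = zeta ^+ k.
Proof. exact: prim_expr_mod zetaP k. Qed.

(** Row v evaluates a coordinate column at zeta^v and is a left eigenvector of X, so this matrix
    diagonalises every circulant. *)
Definition fourier : 'M[K]_m := \matrix_(v, i) zeta ^+ (v * i).

Lemma fourier_unit : fourier \in unitmx.
Proof.
have -> : fourier = (Vandermonde m (\row_v zeta ^+ v))^T.
  by apply/matrixP => v i; rewrite !mxE exprM.
rewrite unitmx_tr unitmxE det_Vandermonde unitfE.
apply/prodf_neq0 => i _; apply/prodf_neq0 => j lt_ij.
rewrite !mxE subr_eq0 (eq_prim_root_expr zetaP) !modn_small ?ltn_ord //.
by rewrite gtn_eqF.
Qed.

Lemma fourier_circ_X :
  fourier *m map_mx iota X = diag_mx (\row_v zeta ^+ v) *m fourier.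
Proof.
apply/matrixP => v j; rewrite mul_diag_mx !mxE.
rewrite (bigD1 (ordS j)) //= big1 => [|i neq_ij].
  rewrite !mxE -exprS cyc_qX_exp coefXn eqxx rmorph1 mulr1 addr0.
  by rewrite -exprD -mulnS -zeta_mod modnMmr zeta_mod.
rewrite !mxE -exprS cyc_qX_exp coefXn.
have /negPf -> : (i : nat) != (j.+1 %% m)%N by [].
by rewrite rmorph0 mulr0.
Qed.

Definition ev (a : {poly F}) v : K := (map_poly iota a).[zeta ^+ v].

Lemma fourier_horner a :
  fourier *m map_mx iota (horner_mx X a)
    = diag_mx (\row_(v < m) ev a v) *m fourier.
Proof.
rewrite map_horner_mx.
have XE : diag_mx (\row_v zeta ^+ v)
          = fourier *m map_mx iota X *m invmx fourier.
  by rewrite fourier_circ_X mulmxK ?fourier_unit.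
have := horner_mx_uconj (map_poly iota a) (map_mx iota X) fourier_unit.
rewrite -XE horner_mx_diag => /(congr1 (mulmxr fourier)) /=.
rewrite mulmxKV ?fourier_unit // => <-; congr (diag_mx _ *m _).
by apply/rowP => v; rewrite !mxE.
Qed.

Lemma ev_mod a v : ev a (v %% m) = ev a v.
Proof. by rewrite /ev zeta_mod. Qed.

Let frob_sum (I : finType) (f : I -> K) :
  (\sum_i f i) ^+ q = \sum_i f i ^+ q.
Proof.
apply: (big_morph (fun x => x ^+ q)); first exact: exprD_card_finField iota.
by rewrite expr0n gtn_eqF // ltnW // finNzRing_gt1.
Qed.

Lemma ev_frob a v : ev a (q * v) = ev a v ^+ q.
Proof.
rewrite /ev !horner_coef frob_sum; apply: eq_bigr => i _.
rewrite coef_map exprMn /= -rmorphXn expf_card -!exprM.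
by congr (_ * _ ^+ _); lia.
Qed.

(** The inverse Fourier transform c of d has coefficients in K. Its q-th power has the same
    transform, so c is fixed by Frobenius and comes from F. *)
Lemma interpolation (d : nat -> K) :
    (forall v, d (v %% m)%N = d v) -> (forall v, d (q * v)%N = d v ^+ q) ->
  exists a, forall v, ev a v = d v.
Proof.
move=> dm dq; pose c : 'cV[K]_m := invmx fourier *m \col_(v < m) d v.
have cE v : \sum_(i < m) zeta ^+ (v * i) * c i 0 = d v.
  have := mulKVmx fourier_unit (\col_(v < m) d v); rewrite -/c.
  move=> /colP/(_ (inord (v %% m))); rewrite !mxE inordK ?ltn_mod // dm => <-.
  apply: eq_bigr => i _; rewrite [fourier _ _]mxE inordK ?ltn_mod //.
  by rewrite -[in RHS]zeta_mod modnMml zeta_mod.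
have c_frob i : c i 0 ^+ q = c i 0.
  pose c' : 'cV[K]_m := \col_i (c i 0 ^+ q).
  suff : c' = c by move/colP/(_ i); rewrite mxE.
  apply: (can_inj (mulKmx fourier_unit)); apply/colP => v.
  (* Multiplication by q^(n-1) inverts multiplication by q mod m. *)
  have [w vE] : exists w, (q * w = v %[mod m])%N.
    exists (q ^ n.-1 * v)%N; rewrite mulnA -expnS prednK //.
    by rewrite -modnMml qn1 modnMml mul1n.
  transitivity (d v); last first.
    by rewrite -cE mxE; apply: eq_bigr => j _; rewrite [fourier _ _]mxE.
  rewrite -dm -vE dm dq -(cE w) frob_sum mxE; apply: eq_bigr => j _.
  rewrite [fourier _ _]mxE [c' _ _]mxE exprMn -exprM; congr (_ * _).
  rewrite (_ : w * j * q = q * w * j)%N; last by lia.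
  by rewrite -zeta_mod -[RHS]zeta_mod -modnMml -[in RHS]modnMml vE.
have /fin_all_exists[b bE] i : exists y, c i 0 = iota y.
  exact: finField_fixed (c_frob i).
exists (\poly_(i < m) b (inord i)) => v.
rewrite /ev -cE (horner_coef_wide _ (_ : _ <= m)%N); last first.
  by rewrite size_map_poly size_poly.
apply: eq_bigr => i _; rewrite coef_map coef_poly ltn_ord inord_val /= -bE.
by rewrite mulrC exprM.
Qed.

Definition has_evals (g : {'GL_m[F]}) (d : nat -> K) : bool :=
  fourier *m map_mx iota (GLval g) == diag_mx (\row_(v < m) d v) *m fourier.

Lemma has_evals_inj g h d : has_evals g d -> has_evals h d -> g = h.
Proof.
move=> /eqP gd /eqP; rewrite -gd => /(can_inj (mulKmx fourier_unit)).
by move=> /map_mx_inj hg; apply: val_inj.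
Qed.

Lemma has_evals_fun g (d d' : nat -> K) (v : 'I_m) :
  has_evals g d -> has_evals g d' -> d v = d' v.
Proof.
move=> /eqP gd /eqP; rewrite gd => /(can_inj (mulmxK fourier_unit)).
by move=> /matrixP/(_ v v); rewrite !mxE eqxx !mulr1n.
Qed.

Lemma has_evalsM g h d d' :
  has_evals g d -> has_evals h d' -> has_evals (g * h)%g (fun v => d v * d' v).
Proof.
move=> /eqP gd /eqP hd; rewrite /has_evals GL_MxE map_mxM mulmxA gd -mulmxA hd.
rewrite mulmxA mulmx_diag; apply/eqP; congr (diag_mx _ *m _).
by apply/rowP => v; rewrite !mxE.
Qed.

Lemma has_evals1 : has_evals 1%g (fun=> 1).
Proof.
rewrite /has_evals GL_1E map_mx1 mulmx1.
have -> : \row_(v < m) (1 : K) = const_mx 1 by apply/rowP => v; rewrite !mxE.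
by rewrite diag_const_mx mul1mx.
Qed.

Lemma has_evals_eq g (d d' : nat -> K) :
  (forall v : 'I_m, d v = d' v) -> has_evals g d -> has_evals g d'.
Proof.
move=> dd' /eqP gd; apply/eqP; rewrite gd; congr (diag_mx _ *m _).
by apply/rowP => v; rewrite !mxE dd'.
Qed.

(** X fixes the all-ones vector; hence the condition C 1 = 1 becomes [ev a 0 = 1]. *)
Lemma horner_circ_X_1 a :
  horner_mx X a *m const_mx 1 = const_mx a.[1] :> 'cV_m.
Proof.
have X1 : X *m const_mx 1 = const_mx 1 :> 'cV_m.
  by have := circ_XGL_in F m; rewrite inE => /andP[_ /eqP].
elim/poly_ind: a => [|a c IHa].
  by rewrite rmorph0 mul0mx horner0; apply/colP => i; rewrite !mxE.
rewrite rmorphD rmorphM /= horner_mx_X horner_mx_C mulmxDl -mulmxA X1 IHa.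
rewrite mul_scalar_mx !hornerE; apply/colP => i; rewrite !mxE; ring.
Qed.

Lemma ev0 a : ev a 0 = iota a.[1].
Proof. by rewrite /ev expr0 -(rmorph1 iota) horner_map. Qed.

Lemma circ_units1_evals g : g \in circ_units1 F m ->
  exists a, [/\ has_evals g (ev a), forall v, ev a v != 0 & ev a 0 = 1].
Proof.
rewrite inE => /andP[]; rewrite inE.
move=> /andP[/circ_algP[a ga] /circ_algP[b gb]] /eqP g1.
have ga' : has_evals g (ev a) by rewrite /has_evals ga fourier_horner.
have gb' : has_evals g^-1%g (ev b) by rewrite /has_evals gb fourier_horner.
exists a; split=> // [v|].
  have := has_evalsM ga' gb'; rewrite mulgV.
  move=> /(has_evals_fun (Ordinal (ltn_pmod v (ltn0Sn r))))/(_ has_evals1) /=.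
  rewrite !ev_mod => ab1; apply/negP => /eqP a0; have /eqP := ab1.
  by rewrite a0 mul0r eq_sym oner_eq0.
rewrite ev0; move: g1; rewrite ga horner_circ_X_1 => /colP/(_ 0).
by rewrite !mxE => ->; rewrite rmorph1.
Qed.

(** Interpolating 1/d as well shows that the inverse matrix is again a polynomial in X. *)
Lemma has_evals_exists d :
    (forall v, d (v %% m)%N = d v) -> (forall v, d (q * v)%N = d v ^+ q) ->
    (forall v, d v != 0) -> d 0%N = 1 ->
  exists2 g, g \in circ_units1 F m & has_evals g d.
Proof.
move=> dm dq d_neq0 d0.
have [a aE] := interpolation dm dq.
have [v|v|b bE] := @interpolation (fun v => (d v)^-1).
- by rewrite dm.
- by rewrite dq exprVn.
have AB1 : horner_mx X a * horner_mx X b = 1.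
  apply: (@map_mx_inj _ _ iota); apply: (can_inj (mulKmx fourier_unit)).
  rewrite map_mxM mulmxA fourier_horner -mulmxA fourier_horner mulmxA.
  rewrite mulmx_diag.
  rewrite map_mx1 mulmx1 -[RHS]mul1mx -diag_const_mx; congr (diag_mx _ *m _).
  by apply/rowP => v; rewrite !mxE aE bE mulfV.
have Aunit : horner_mx X a \is a GRing.unit by have [] := mulmx1_unit AB1.
pose g : {'GL_m[F]} := FinRing.unit 'M[F]_m.-1.+1 Aunit.
have gV : GLval g^-1%g = horner_mx X b.
  by rewrite GL_VE -[RHS](mulKr Aunit) AB1 mulr1.
exists g.
  rewrite inE; apply/andP; split; last first.
    apply/eqP; rewrite [GLval _]/= horner_circ_X_1; congr const_mx.
    by apply: (fmorph_inj iota); rewrite -ev0 aE d0 rmorph1.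
  rewrite inE gV; apply/andP; split; apply/circ_algP; last by exists b.
  by exists a.
rewrite /has_evals [GLval _]/= fourier_horner; apply/eqP.
congr (diag_mx _ *m _).
by apply/rowP => v; rewrite !mxE aE.
Qed.

(** * Parametrisation of C'(m,q) by exponents of [gam] *)

Definition gam_pow (u : 'cV[int]_r) v : K := gam ^ ext (trace_vec q n u) v.

Let gamN (z : int) : gam ^ (z *+ N) = 1.
Proof.
by apply/eqP; rewrite (exprz_prim_eq1 _ gamP) -mulr_natr natz dvdz_mull.
Qed.

Let gamMn (z : int) k : gam ^ (z *+ k) = (gam ^ z) ^+ k.
Proof. by rewrite -mulr_natr natz -exprz_exp -exprnP. Qed.

Let eps_trace u : eps_mx r q *m trace_vec q n u = u *+ N.
Proof. by rewrite eps_trace_vec // qn mulrSr addrK. Qed.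

Let trace_eps u : trace_vec q n (eps_mx r q *m u) = u *+ N.
Proof. by rewrite trace_vec_eps // qn mulrSr addrK. Qed.

Let divN (y : 'cV[int]_r) :
  (forall v, gam ^ ext y v = 1) -> exists w, y = w *+ N.
Proof.
move=> y1; exists (\col_i (y i 0%R %/ N)%Z); apply/colP => i.
rewrite mulmxnE mxE -mulr_natr natz divzK //.
by rewrite -(exprz_prim_eq1 _ gamP) -ext_ord y1.
Qed.

Lemma gam_powD u w v : gam_pow (u + w) v = gam_pow u v * gam_pow w v.
Proof. by rewrite /gam_pow trace_vecD extD expfzDr. Qed.

(** For h = M' u, M h = N u gives q h(v) = h(q v) mod N, which is d(q v) = d(v)^q for d = gam^h. *)
Lemma gam_pow_evals u :
  exists2 g, g \in circ_units1 F m & has_evals g (gam_pow u).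
Proof.
apply: has_evals_exists => [v|v|v|]; rewrite /gam_pow.
- by rewrite ext_mod.
- have /(canRL (subKr _)) -> :
      ext (trace_vec q n u) v *+ q - ext (trace_vec q n u) (q * v)
      = ext u v *+ N.
    by rewrite -ext_eps_mx eps_trace extMn.
  by rewrite expfzDr // -mulNrn gamN mulr1 gamMn.
- exact: expfz_neq0.
- by rewrite ext0.
Qed.

(* The circulant whose eigenvalue at the character x |-> zeta^v is gam to the
   exponent (trace_vec u)_v; the default 1 is never taken (PsiP). *)
Definition Psi u : {'GL_m[F]} :=
  odflt 1%g [pick g in circ_units1 F m | has_evals g (gam_pow u)].

Lemma PsiP u : Psi u \in circ_units1 F m /\ has_evals (Psi u) (gam_pow u).
Proof.
rewrite /Psi; case: pickP => [g /andP[] //|no_g].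
by have [g Cg gu] := gam_pow_evals u; have := no_g g; rewrite Cg gu.
Qed.

Lemma PsiE u g : has_evals g (gam_pow u) -> Psi u = g.
Proof. by apply: has_evals_inj; have [] := PsiP u. Qed.

Lemma PsiD : {morph Psi : u w / u + w >-> (u * w)%g}.
Proof.
move=> u w; apply: PsiE; have [[_ uP] [_ wP]] := (PsiP u, PsiP w).
by apply: has_evals_eq (has_evalsM uP wP) => v; rewrite gam_powD.
Qed.

(** If h is the logarithm of the eigenvalues, then M h = N u for some u. Applying M' gives N h = N
    M' u, hence h = M' u. *)
Lemma Psi_onto g : g \in circ_units1 F m <-> exists u, Psi u = g.
Proof.
split=> [Cg|[u <-]]; last by have [] := PsiP u.
have [a [ga a_neq0 a0]] := circ_units1_evals Cg.
have /fin_all_exists[k kE] (i : 'I_r) : exists k, ev a i.+1 = gam ^+ k.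
  have [|k ->] := prim_rootP gamP (_ : ev a i.+1 ^+ N = 1); last by exists k.
  apply: (mulfI (a_neq0 i.+1)).
  by rewrite -exprS (ltn_predK (finNzRing_gt1 K)) expf_card mulr1.
pose h : 'cV[int]_r := \col_i (k i)%:Z.
have hE v : gam ^ ext h v = ev a v.
  rewrite -ext_mod -ev_mod; have: (v %% m < m)%N by rewrite ltn_mod.
  case: (v %% m)%N => [_|i lt_i]; first by rewrite ext0 a0.
  rewrite (ext_ord h (Ordinal (lt_i : (i < r)%N))) mxE -exprnP.
  by rewrite -(kE (Ordinal (lt_i : (i < r)%N))).
have [|u hu] := @divN (eps_mx r q *m h) => [v|].
  rewrite ext_eps_mx expfzDr // gamMn -invr_expz !hE ev_frob.
  by rewrite divff ?expf_neq0.
exists u; apply: PsiE; apply: has_evals_eq ga => v; rewrite -hE /gam_pow.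
suff -> : h = trace_vec q n u by [].
by apply: (mulcn_inj N_gt0); rewrite -trace_eps hu trace_vecMn.
Qed.

(** If M' u = N w then N u = M M' u = N M w, hence u = M w. Conversely M' M w = N w has trivial
    exponentials. *)
Lemma Psi_eq1 u : Psi u = 1%g <-> exists w, u = eps_mx r q *m w.
Proof.
split=> [u1|[w ->]].
  have [_ uP] := PsiP u; rewrite u1 in uP.
  have [|w tu] := @divN (trace_vec q n u) => [v|].
    rewrite -ext_mod.
    exact: (has_evals_fun (Ordinal (ltn_pmod v (ltn0Sn r))) uP has_evals1).
  exists w; apply: (mulcn_inj N_gt0) => /=.
  by rewrite -eps_trace tu -raddfMn.
apply: PsiE; apply: has_evals_eq has_evals1 => v.
by rewrite /gam_pow trace_eps extMn gamN.
Qed.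

(** From m M' [x_vec] = M' M l = N l follows M' [x_vec] = (N/m) l, the logarithm of v |-> zeta^v. *)
Lemma Psi_x_vec : Psi (x_vec r q) = circ_XGL F m.
Proof.
apply: PsiE.
suff: has_evals (circ_XGL F m) (fun v => zeta ^+ v).
  apply: has_evals_eq => v.
  suff tx : ext (trace_vec q n (x_vec r q)) v = (v * (N %/ m))%N%:Z.
    by rewrite /gam_pow tx -exprnP mulnC exprM zetaE.
  have := trace_eps (lin_vec r); rewrite -x_vecMm trace_vecMn.
  move=> /(congr1 (fun y => ext y v)); rewrite !extMn ext_lin_vec modn_small //.
  rewrite -{1}(divnK mN) mulrnA => /Num.Theory.pmulrnI -> //.
  by rewrite -mulr_natr natz PoszM.
by rewrite /has_evals -fourier_circ_X.
Qed.

(** * The two isomorphisms *)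

Lemma isog_Sigma : isog_zmod (circ_units1 F m) (Sigma_group m q).
Proof.
apply: (isog_lattice_quot (@Zgens_free r) (@Egens_comb r q) (unitmx1 _ _) PsiD).
  exact: Psi_onto.
move=> u; apply: iff_trans (Psi_eq1 u) _.
by split=> -[w uw]; exists w; move: uw; rewrite mul1mx.
Qed.

Lemma isog_sandpile :
  isog_zmod (circ_units1 F m / <[circ_XGL F m]>)%g (sandpile_group m q).
Proof.
(* Values of [Psi] commute, hence normalise <X>; on the normaliser [coset] is a morphism with kernel
   <X>. *)
have PsiN u : Psi u \in 'N(<[circ_XGL F m]>)%g.
  apply: (subsetP (cent_sub _)); rewrite cent_cycle; apply/cent1P.
  by rewrite -Psi_x_vec /commute -!PsiD addrC.
have PsiMn u k : Psi (u *+ k) = (Psi u ^+ k)%g.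
  elim: k => [|k IHk]; last by rewrite mulrS PsiD IHk expgS.
  by rewrite mulr0n; apply/Psi_eq1; exists 0; rewrite mulmx0.
have PsiV u : Psi (- u) = (Psi u)^-1%g.
  by apply: (mulgI (Psi u)); rewrite -PsiD subrr mulgV; apply: (PsiMn u 0).
apply: (isog_lattice_quot (Psi := fun u => coset <[circ_XGL F m]> (Psi u))
         (@Zgens_free r) (@Fgens_comb r q) (diff_mx_unit r)).
- by move=> u w; rewrite PsiD morphM.
- move=> g; split=> [/morphimP[x _ /Psi_onto[u <-] ->]|[u <-]].
    by exists u.
  by apply: mem_quotient; apply/Psi_onto; exists u.
move=> u; apply: iff_trans (diff_in_f_mxP q u).
apply: (@iff_trans _ (Psi u \in <[circ_XGL F m]>%g)).
  split=> [u1|/coset_id //]; exact: coset_idr u1.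
(* [Psi u] = X^c means that u - c [x_vec] lies in the kernel M Z^r of [Psi]. *)
split=> [/cycleP[c]|[w [c ->]]].
  rewrite -Psi_x_vec -PsiMn => uc.
  have /Psi_eq1[w uw] : Psi (u - x_vec r q *+ c) = 1%g.
    by rewrite PsiD PsiV uc mulgV.
  by exists w, c%:Z; rewrite -uw subrK.
have -> : Psi (eps_mx r q *m w + x_vec r q *~ c) = Psi (x_vec r q *~ c).
  by rewrite PsiD (_ : Psi (_ *m w) = 1%g) ?mul1g //; apply/Psi_eq1; exists w.
case: c => c; first by rewrite -pmulrn PsiMn Psi_x_vec mem_cycle.
by rewrite NegzE mulrNz -pmulrn PsiV PsiMn Psi_x_vec groupV mem_cycle.
Qed.

End Circulant.

Local Close Scope ring_scope.

Theorem theorem6p1 (p k q : nat) (p_prime : prime p) (k_gt0 : 0 < k)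
    (q_def : q = p ^ k) (F : finFieldType) (card_F : #|F| = q)
    (m : nat) (m_gt0 : 0 < m) (co_mq : coprime m q) :
  isog_zmod (circ_units1 F m) (Sigma_group m q) /\
  isog_zmod (circ_units1 F m / <[circ_XGL F m]>)%g (sandpile_group m q).
Proof.
(* For m = [r.+1] the size [m.-1.+1] reduces to m. *)
case: m m_gt0 co_mq => // r _; rewrite -card_F => co_mq.
have [K [iota [n [oK mN]]]] := finField_ext_unity_roots co_mq.
have [gam gamP] := finField_generator K.
split; first exact: (isog_Sigma iota oK mN gamP erefl).
exact: (isog_sandpile iota oK mN gamP erefl).
Qed.
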